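(* Define by recursion on $m \geq 2$, for all $\delta > 0$, $K : (0,\infty) \to (0, \infty)$ and finite sequences $\{\alpha_i\}_i \subseteq (0,1)$ of the appropriate length, $$\Psi(2,\{\alpha_i\}_{i=1}^2,K,\delta):=\Phi(\alpha_1,\alpha_2,K,\delta),$$ $$\Psi(m+1,\{\alpha_i\}_{i=1}^{m+1},K,\delta):=\Phi\big(\alpha_1\star\cdots\star\alpha_m,\ \alpha_{m+1},\ \rho\mapsto\max(\Psi(m,\{\alpha_i\}_{i=1}^m,K,\rho),K(\rho)),\ \delta\big),$$ where $\Phi$ and $\star$ are the explicit functions given in the context. Let $X$ be a Hilbert space. Let $m \geq 2$, $\alpha_1,\ldots,\alpha_m \in (0,1)$ and $R_1,\ldots,R_m:X \to X$ be such that for each $i$, $R_i$ is $\alpha_i$-averaged. Put $R:=R_m \circ\cdots\circ R_1$. Let $K: (0,\infty) \to (0,\infty)$ be such that for all $i \in \{1,\ldots,m\}$ and all $\varepsilon > 0$ there is a $p \in X$ with $\|p\| \leq K(\varepsilon)$ and $\|p-R_ip\| \leq \varepsilon$. Then for all $\delta > 0$ there is a $p \in X$ with $\|p\| \leq \Psi(m,\{\alpha_i\}_{i=1}^m,K,\delta)$ and $\|p-Rp\| \leq \delta$.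
   Context: Averaged mappings. Let $X$ be a Hilbert space. A mapping $T: X \to X$ is nonexpansive if $\|Tx-Ty\| \leq \|x-y\|$ for all $x,y \in X$. For $\alpha \in (0,1)$, a mapping $R:X \to X$ is $\alpha$-averaged if there is a nonexpansive $T:X \to X$ such that $Rx = (1-\alpha)x+\alpha Tx$ for all $x \in X$. The operation $\star$. For $\alpha,\beta \in (0,1)$, $$\alpha\star\beta := \frac{\alpha+\beta-2\alpha\beta}{1-\alpha\beta} = \frac1{1+\frac1{\frac\alpha{1-\alpha} + \frac\beta{1-\beta}}}.$$ This operation is associative and commutative, and for $m \ge 2$, $\alpha_1 \star\cdots \star\alpha_m = \Big(1+\big(\sum_{i=1}^m \frac{\alpha_i}{1-\alpha_i}\big)^{-1}\Big)^{-1}$. The function $\Theta$. For $\beta, L_1, L_2, L_3 > 0$, $$\Theta(\beta,L_1,L_2,L_3):=(L_1+L_2) \left(L_3 + \frac{L_1+L_2+2\beta L_3 + \sqrt{L_1^2 + L_2^2 + 2L_1L_2 + 8\beta L_1L_3 + 4\beta L_2L_3}}{2\beta}\right).$$ The functions $B$ and $\Phi$. For $\alpha_1,\alpha_2 \in (0,1)$, $\delta > 0$ and $K : (0,\infty) \to (0, \infty)$, $$B(\alpha_2,K,\delta):=\sqrt{\left(K\left(\tfrac\delta4\right)+\tfrac\delta8\right)^2 + 2\,\Theta\left(\alpha_2^{-1}-1,\ K\left(\tfrac\delta4\right)+\tfrac\delta8,\ K\left(\tfrac\delta4\right)+\tfrac\delta8,\ \tfrac\delta8\right)},$$ $$\Phi(\alpha_1,\alpha_2,K,\delta):=B(\alpha_2,K,\delta)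 \cdot \max\left(\sqrt{2}, \frac{4B(\alpha_2,K,\delta)}\delta \right) \cdot \frac1{1-\alpha_1} + \frac{\alpha_1}{1-\alpha_1} \left(K\left(\tfrac\delta4\right)+\tfrac\delta8\right) + \frac\delta8.$$ For $m=2$ (the innermost case) the first argument of $\Psi(3,\cdot)$'s $\Phi$ is $\alpha_1\star\alpha_2$, and so on. *)

(* Defs.v *)
From HB Require Import structures.
From mathcomp Require Import all_boot all_order all_algebra.
From mathcomp Require Import all_classical all_reals all_analysis.

Set Implicit Arguments.
Unset Strict Implicit.
Unset Printing Implicit Defensive.

Import Order.TTheory GRing.Theory Num.Theory.
Import numFieldNormedType.Exports.

Local Open Scope ring_scope.

(* Real Hilbert spaces. A complex Hilbert space is one too, with the real part
   of its inner product, which induces the same norm. *)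
HB.mixin Record isHilbert (R : realType) X of CompleteNormedModule R X := {
  inner : {dot X for (idfun : R -> R)} ;
  innerxx : forall x : X, inner x x = `|x| ^+ 2
}.

#[short(type="hilbertType")]
HB.structure Definition Hilbert (R : realType) :=
  {X of isHilbert R X & CompleteNormedModule R X}.

Definition nonexpansive (R : realType) (X : hilbertType R) (T : X -> X) : Prop :=
  forall x y : X, `|T x - T y| <= `|x - y|.

(* Meant for 0 < a < 1, which is assumed wherever this is used. *)
Definition averaged (R : realType) (X : hilbertType R) (a : R) (f : X -> X) : Prop :=
  exists T : X -> X,
    nonexpansive T /\ forall x : X, f x = (1 - a) *: x + a *: T x.

(* A finite sequence u_1, ..., u_n is a function u : 'I_n -> A, so u_i is the
   value of u at the ordinal i - 1. *)
Definition init (A : Type) (n : nat) (u : 'I_n.+1 -> A) : 'I_n -> A :=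
  fun i => u (widen_ord (leqnSn n) i).

(* f_n \o ... \o f_1 *)
Fixpoint comp_all (A : Type) (n : nat) : ('I_n -> A -> A) -> A -> A :=
  match n with
  | 0 => fun _ => id
  | k.+1 => fun f => f ord_max \o comp_all (init f)
  end.

Definition star (R : realType) (a b : R) : R :=
  (a + b - 2 * a * b) / (1 - a * b).

(* (... (u_1 * u_2) * ...) * u_n; the value for n = 0 is a dummy. *)
Fixpoint star_all (R : realType) (n : nat) : ('I_n -> R) -> R :=
  match n with
  | 0 => fun _ => 0
  | k.+1 => fun u =>
      match k with
      | 0 => u ord0
      | _ => star (star_all (init u)) (u ord_max)
      end
  end.

Definition Theta (R : realType) (b L1 L2 L3 : R) : R :=
  (L1 + L2) *
  (L3 + (L1 + L2 + 2 * b * L3 +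
         Num.sqrt (L1 ^+ 2 + L2 ^+ 2 + 2 * L1 * L2 + 8 * b * L1 * L3
                   + 4 * b * L2 * L3)) / (2 * b)).

Definition B (R : realType) (a2 : R) (K : R -> R) (d : R) : R :=
  Num.sqrt ((K (d / 4) + d / 8) ^+ 2 +
            2 * Theta (a2^-1 - 1) (K (d / 4) + d / 8) (K (d / 4) + d / 8) (d / 8)).

Definition Phi (R : realType) (a1 a2 : R) (K : R -> R) (d : R) : R :=
  B a2 K d * Num.max (Num.sqrt 2) (4 * B a2 K d / d) * (1 / (1 - a1)) +
  a1 / (1 - a1) * (K (d / 4) + d / 8) + d / 8.

(* The values for m = 0 and m = 1 are dummies. *)
Fixpoint Psi (R : realType) (m : nat) : ('I_m -> R) -> (R -> R) -> R -> R :=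
  match m with
  | 0 => fun _ _ _ => 0
  | n.+1 => fun a K d =>
      match n with
      | 0 => 0
      | 1 => Phi (a ord0) (a ord_max) K d
      | _ => Phi (star_all (init a)) (a ord_max)
                 (fun r => Num.max (Psi (init a) K r) (K r)) d
      end
  end.

(* Main.v *)
(* For one composition step, only the second map needs to be averaged. Let [f]
   be nonexpansive, [g] averaged, [b = a2^-1 - 1], and let [p], [q] be almost
   fixed by [f], [g]. For [e > 0] the contraction [(1 + e)^-1 *: g (f x)] has a
   fixed point [x], so that [`|x - g (f x)| = e * `|x|]. Add the inequality
   [`|f x - f p| <= `|x - p|] to the one satisfied by [g] at [f x] and [q],
   both squared: the displacement of [g] enters linearly, and is absorbed by the
   quadratic term that [g] gains from being averaged. What remains bounds
   [e * `|x| ^+ 2], hence [e * `|x|] for small [e]. *)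
Require Import Defs.
From mathcomp Require Import all_boot all_order all_algebra.
From mathcomp Require Import all_classical all_reals all_analysis.
From mathcomp Require Import ring lra.

Set Implicit Arguments.
Unset Strict Implicit.
Unset Printing Implicit Defensive.

Import Order.TTheory GRing.Theory Num.Theory.
Import numFieldNormedType.Exports.

Local Open Scope ring_scope.

(** * Inner product calculus *)

Section InnerProduct.
Context {R : realType} {X : hilbertType R}.
Implicit Types (u v w x : X) (a : R).

Lemma innerDl u v w : inner (u + v) w = inner u w + inner v w.
Proof. exact: linearDl. Qed.

Lemma innerDr u v w : inner u (v + w) = inner u v + inner u w.
Proof. exact: linearDr. Qed.

Lemma innerNl u v : inner (- u) v = - inner u v.
Proof. exact: linearNl. Qed.

Lemma innerNr u v : inner u (- v) = - inner u v.
Proof. exact: linearNr. Qed.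

Lemma innerZl a u v : inner (a *: u) v = a * inner u v.
Proof. exact: linearZl_LR. Qed.

Lemma innerZr a u v : inner u (a *: v) = a * inner u v.
Proof. exact: linearZr_LR. Qed.

Lemma innerC u v : inner u v = inner v u.
Proof. by rewrite hermC expr0 mul1r. Qed.

Definition innerE := (innerDl, innerDr, innerNl, innerNr, innerZl, innerZr).

(** Cauchy-Schwarz: the squared norm of |v|u - |u|v is nonnegative and equals 2|u||v|(|u||v| -
    <u,v>). *)
Lemma inner_ler_norm u v : inner u v <= `|u| * `|v|.
Proof.
have [->|v0] := eqVneq v 0.
  by rewrite normr0 mulr0 -(scale0r (0 : X)) innerZr mul0r.
have hv : 0 < `|v| by rewrite normr_gt0.
have [->|u0] := eqVneq u 0.
  by rewrite normr0 mul0r -(scale0r (0 : X)) innerZl mul0r.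
have hu : 0 < `|u| by rewrite normr_gt0.
have := sqr_ge0 (`| `|v| *: u - `|u| *: v|).
rewrite -innerxx !innerE (innerC v u) !innerxx => h.
rewrite -subr_ge0 -(pmulr_rge0 _ (mulr_gt0 hu hv)).
nra.
Qed.

End InnerProduct.

(** * Averaged maps *)

(** With d = x - y and t = T x - T y, the difference of the two sides is exactly a(|d|^2 - |t|^2),
    because the displacement of [f] is a times that of T. *)
Lemma averaged_norm_le (R : realType) (X : hilbertType R) (a : R) (f : X -> X) :
  0 < a < 1 -> averaged a f -> forall x y : X,
  `|f x - f y| ^+ 2 + (a^-1 - 1) * `|(x - f x) - (y - f y)| ^+ 2 <= `|x - y| ^+ 2.
Proof.
move=> /andP[a0 a1] [T [hT hf]] x y; rewrite !hf.
set d := x - y; set t := T x - T y.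
have -> : (1 - a) *: x + a *: T x - ((1 - a) *: y + a *: T y)
    = (1 - a) *: d + a *: t.
  by rewrite /d /t !scalerBr opprD addrACA.
have -> : x - ((1 - a) *: x + a *: T x) - (y - ((1 - a) *: y + a *: T y))
    = a *: (d - t).
  have resid u v : u - ((1 - a) *: u + a *: v) = a *: (u - v) :> X.
    by rewrite scalerBl scale1r scalerBr !opprD opprK !addrA subrr add0r.
  by rewrite !resid -scalerBr /d /t !opprD !opprK addrACA.
have ht : `|t| ^+ 2 <= `|d| ^+ 2 by rewrite ler_sqr ?nnegrE ?normr_ge0 //; exact: hT.
move: {x y} d t ht => d t ht.
rewrite -!innerxx !innerE (innerC t d) !innerxx.
rewrite -subr_ge0.
have : 0 <= a * (`|d| ^+ 2 - `|t| ^+ 2).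
  by rewrite mulr_ge0 ?subr_ge0 // ltW.
congr (0 <= _); field; rewrite gt_eqF //.
Qed.

Lemma nonexpansive_averaged (R : realType) (X : hilbertType R) (a : R)
  (f : X -> X) : 0 < a < 1 -> averaged a f -> nonexpansive f.
Proof.
move=> ha hf x y; have := averaged_norm_le ha hf x y => h.
rewrite -ler_sqr ?nnegrE //.
apply: le_trans h; rewrite lerDl mulr_ge0 ?sqr_ge0 // subr_ge0.
by case/andP: ha => a0 a1; rewrite invf_ge1 // ltW.
Qed.

(** * Approximate fixed points of a composition of two maps *)

Lemma nonexpansive_fixpoint (R : realType) (X : hilbertType R) (g : X -> X)
  (e : R) : 0 < e -> nonexpansive g -> exists x : X, g x = (1 + e) *: x.
Proof.
move=> e0 hg; have e1 : 0 < 1 + e by lra.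
pose h : {fun [set: X] >-> [set: X]} := totalfun (fun x => (1 + e)^-1 *: g x).
have hc : is_contraction h.
  have q0 : 0 <= (1 + e)^-1 by rewrite invr_ge0 ltW.
  exists (NngNum q0); split => /=.
    by rewrite invf_lt1 //; lra.
  case=> x y _ /=.
  by rewrite -scalerBr normrZ ger0_norm // ler_wpM2l.
have [|x _ hx] := banach_fixed_point hc closedT; first by exists 0.
exists x; rewrite [in RHS]hx /= scalerA divff ?scale1r // gt_eqF //.
Qed.

Lemma fixpoint_norm_bound (R : realType) (X : hilbertType R) (f g : X -> X)
    (b e h k : R) (x p q : X) :
  0 < b -> 0 < e -> 0 < h -> nonexpansive f ->
  (forall u v, `|g u - g v| ^+ 2 + b * `|(u - g u) - (v - g v)| ^+ 2
               <= `|u - v| ^+ 2) ->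
  g (f x) = (1 + e) *: x ->
  `|p| <= k -> `|p - f p| <= 2 * h -> `|q| <= k -> `|q - g q| <= 2 * h ->
  (2 * e + e ^+ 2) * `|x| ^+ 2 <=
    4 * (k + h) ^+ 2 / b + 12 * h * (k + h) + 8 * (1 + e) * h * `|x|
    + 2 * e * `|x| * (k + h).
Proof.
move=> b0 e0 h0 hf hg hx hp hp' hq hq'.
have k0 : 0 <= k by apply: le_trans hp.
have hfxp : `|f x - f p| ^+ 2 <= `|x - p| ^+ 2.
  by rewrite ler_sqr ?nnegrE ?normr_ge0 //; exact: hf.
have := hg (f x) q; rewrite hx.
move: (f x) (f p) (g q) hfxp hp' hq' => {f g hf hg hx} y y1 z2 hfxp hp' hq' hg.
(* Now [y], [y1], [z2] stand for f x, f p, g q. Thus [r] and [s] are the small displacements at [p]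
   and [q], and [w] is the displacement of g at [y] minus the one at [q]. *)
pose r := p - y1; pose s := q - z2; pose w := y - (1 + e) *: x - s.
pose t := q - y1.
have hr : `|r| <= 2 * h by [].
have hs : `|s| <= 2 * h by [].
have hy1 : `|y1| <= k + 2 * h.
  have -> : y1 = p - r by rewrite /r opprB addrC subrK.
  by rewrite (le_trans (ler_normB _ _)) // lerD.
have hpy : `|p + y1| <= 2 * (k + h).
  rewrite (le_trans (ler_normD _ _)) //; lra.
have ht : `|t| <= 2 * (k + h).
  rewrite (le_trans (ler_normB _ _)) //; lra.
(* Completing the square: |bw + t|^2 >= 0 bounds the left side by |t|^2 / b. *)
have hw : - (2 * inner w t) - b * `|w| ^+ 2 <= 4 * (k + h) ^+ 2 / b.
  rewrite ler_pdivlMr //.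
  have : `|t| ^+ 2 <= (2 * (k + h)) ^+ 2 by rewrite ler_sqr ?nnegrE //; lra.
  have := sqr_ge0 `|b *: w + t|.
  rewrite -innerxx; move: (w) (t) => w' t'.
  rewrite !innerE (innerC t' w') !innerxx; lra.
have hrp : inner r (p + y1) <= 4 * h * (k + h).
  apply: (le_trans (inner_ler_norm _ _)).
  apply: (@le_trans _ _ (2 * h * (2 * (k + h)))); last by lra.
  exact: ler_pM.
have hsy : inner s y1 <= 4 * h * (k + h).
  apply: (le_trans (inner_ler_norm _ _)).
  apply: (@le_trans _ _ (2 * h * (k + 2 * h))); first exact: ler_pM.
  nra.
have hxr : - inner x r <= 2 * h * `|x|.
  rewrite mulrC -innerNr; apply: (le_trans (inner_ler_norm _ _)).
  by rewrite normrN ler_wpM2l.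
have hxs : - inner x s <= 2 * h * `|x|.
  rewrite mulrC -innerNr; apply: (le_trans (inner_ler_norm _ _)).
  by rewrite normrN ler_wpM2l.
have hxp : inner x p <= `|x| * (k + h).
  apply: (le_trans (inner_ler_norm _ _)); rewrite ler_wpM2l //; lra.
(* The right side is the sum of the two squared inequalities, hence at most 0. Writing [p], [q],
   [y], [z2] through [r], [s], [t], [w], [x], [y1] makes this a polynomial identity in inner
   products. *)
have ident : (2 * e + e ^+ 2) * `|x| ^+ 2 + b * `|w| ^+ 2 + 2 * inner w t
    - inner r (p + y1) - 2 * inner s y1 + `|s| ^+ 2
    + 2 * (1 + e) * (inner x r + inner x s) - 2 * e * inner x p
  = (`|y - y1| ^+ 2 - `|x - p| ^+ 2)
    + (`|(1 + e) *: x - z2| ^+ 2 + b * `|(y - (1 + e) *: x) - (q - z2)| ^+ 2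
       - `|y - q| ^+ 2).
  have -> : z2 = q - s by rewrite /s opprB addrC subrK.
  have -> : y = w + s + (1 + e) *: x by rewrite /w !subrK.
  have -> : w + s + (1 + e) *: x - (1 + e) *: x - (q - (q - s)) = w.
    by rewrite addrK (_ : q - (q - s) = s) ?addrK // opprB addrC subrK.
  have -> : p = r + y1 by rewrite /r subrK.
  have -> : q = t + y1 by rewrite /t subrK.
  move: (w) (s) (r) (t) => w' s' r' t'.
  rewrite -!innerxx !innerE.
  (* Each mixed inner product gets one order of arguments, so that [ring] sees equal atoms. *)
  rewrite ?(innerC s' w') ?(innerC x w') ?(innerC y1 w') ?(innerC t' w').
  rewrite ?(innerC r' w') ?(innerC s' x) ?(innerC y1 x) ?(innerC t' x).
  rewrite ?(innerC r' x) ?(innerC s' y1) ?(innerC t' y1) ?(innerC r' y1).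
  rewrite ?(innerC s' t') ?(innerC s' r') ?(innerC t' r').
  ring.
have hs2 := sqr_ge0 `|s|.
have h1 : - (2 * (1 + e) * (inner x r + inner x s)) <= 8 * (1 + e) * h * `|x|.
  have : 0 <= (1 + e) * (4 * h * `|x| + (inner x r + inner x s)).
    by apply: mulr_ge0; lra.
  lra.
have h2 : 2 * e * inner x p <= 2 * e * `|x| * (k + h).
  rewrite -[leRHS]mulrA ler_wpM2l //; lra.
move: ident hg hfxp hw hrp hsy h1 h2 hs2; lra.
Qed.

(* The parameter of the fixed point is [e = d ^+ 2 / (4 * B ^+ 2)], for which
   [d / e] is the term [4 * B ^+ 2 / d] of [Phi]. The square root in [Theta] is
   not needed for this and is bounded below by 0. *)
Lemma comp_approx_fixpoint (R : realType) (X : hilbertType R) (f g : X -> X)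
    (a1 a2 : R) (K : R -> R) (d : R) (p q : X) :
  0 < a1 < 1 -> 0 < a2 < 1 -> 0 < d -> 0 < K (d / 4) ->
  nonexpansive f -> averaged a2 g ->
  `|p| <= K (d / 4) -> `|p - f p| <= d / 4 ->
  `|q| <= K (d / 4) -> `|q - g q| <= d / 4 ->
  exists x : X, `|x| <= Phi a1 a2 K d /\ `|x - g (f x)| <= d.
Proof.
move=> /andP[a10 a11] ha2 d0 k0 hf hg hp hp' hq hq'.
have b0 : 0 < a2^-1 - 1.
  by case/andP: ha2 => a20 a21; rewrite subr_gt0 invf_gt1.
have hgb := averaged_norm_le ha2 hg.
have gne := nonexpansive_averaged ha2 hg.
set k := K (d / 4) in k0 hp hq; set b := a2^-1 - 1 in b0 hgb.
pose h := d / 8; have h0 : 0 < h by rewrite /h; lra.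
pose L := k + h; have L0 : 0 < L by rewrite /L; lra.
pose S := L ^+ 2 / b; have S0 : 0 < S by rewrite /S divr_gt0 // exprn_gt0.
set BB := B a2 K d.
(* [S] comes from completing the square, and d * L / 2 from the summands of [Theta] that contain d /
   8. *)
have hB : L ^+ 2 + 4 * S + d * L <= BB ^+ 2.
  have hT : 2 * S + d * L / 2 <= Theta b L L (d / 8).
    rewrite /Theta; set rt := Num.sqrt _.
    have rt0 : 0 <= rt by exact: sqrtr_ge0.
    have : 0 <= L * rt / b by rewrite divr_ge0 ?mulr_ge0 // ltW.
    have -> : (L + L) * (d / 8 + (L + L + 2 * b * (d / 8) + rt) / (2 * b)) =
      2 * S + d * L / 2 + L * rt / b.
      by rewrite /S; field; rewrite gt_eqF.
    lra.
  have dL : 0 < d * L by rewrite mulr_gt0.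
  have L2 := sqr_ge0 L.
  rewrite /BB /B sqr_sqrtr -/k -/b -/h -/L; lra.
have BB0 : 0 < BB ^+ 2.
  by apply: lt_le_trans hB; have := mulr_gt0 d0 L0; have := sqr_ge0 L; lra.
have BBge0 : 0 <= BB by exact: sqrtr_ge0.
pose e := d ^+ 2 / (4 * BB ^+ 2).
have e0 : 0 < e by apply: divr_gt0; [exact: exprn_gt0 | exact: mulr_gt0].
have hgf : nonexpansive (g \o f).
  by move=> u v; exact: (le_trans (gne _ _)).
have [x hx] := nonexpansive_fixpoint e0 hgf.
have d4 : d / 4 = 2 * h by rewrite /h; lra.
rewrite d4 in hp' hq'.
have hN := fixpoint_norm_bound b0 e0 h0 hf hgb hx hp hp' hq hq'.
set N := `|x| in hN; have N0 : 0 <= N by exact: normr_ge0.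
have eB : e * BB ^+ 2 = d ^+ 2 / 4 by rewrite /e; field; rewrite -sqrf_eq0 gt_eqF.
have hle : e * N <= d.
  rewrite leNgt; apply/negP => hlt.
  set Q := BB ^+ 2 in hB BB0 eB.
  have dL : 0 < d * L by rewrite mulr_gt0.
  (* If e * N > d, the term 8(1 + e)hN = (1 + e)dN is at most (1 + e)eN^2, which leaves eN^2 on the
     left; 2eNL is split as eN^2 / 2 + 2eL^2. *)
  have hN1 : e * N ^+ 2 <= 8 * S + 3 * d * L + 4 * e * L ^+ 2.
    have : 0 <= (1 + e) * N * (e * N - d) by rewrite !mulr_ge0 //; lra.
    have : 0 <= e * (N - 2 * L) ^+ 2 by rewrite mulr_ge0 ?sqr_ge0 // ltW.
    rewrite -/L -mulrA -/S /h in hN; lra.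
  have hd : d ^+ 2 < e * (8 * S + 3 * d * L + 4 * e * L ^+ 2).
    apply: (@lt_le_trans _ _ ((e * N) ^+ 2)).
      by rewrite ltr_sqr ?nnegrE; lra.
    by rewrite expr2 -mulrA ler_wpM2l ?(ltW e0) //; lra.
  (* Multiply by [Q], replace eQ by d^2 / 4, and cancel d^2. *)
  have hQ : Q < 2 * S + 3 / 4 * d * L + e * L ^+ 2.
    have : 0 < Q * (e * (8 * S + 3 * d * L + 4 * e * L ^+ 2) - d ^+ 2).
      by rewrite mulr_gt0 // subr_gt0.
    have -> : Q * (e * (8 * S + 3 * d * L + 4 * e * L ^+ 2) - d ^+ 2) =
      (e * Q) * (8 * S + 3 * d * L + 4 * e * L ^+ 2) - d ^+ 2 * Q by ring.
    have -> : e * Q * (8 * S + 3 * d * L + 4 * e * L ^+ 2) - d ^+ 2 * Q =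
      d ^+ 2 * (2 * S + 3 / 4 * d * L + e * L ^+ 2 - Q) by rewrite eB; field.
    by rewrite pmulr_rgt0 ?exprn_gt0 // subr_gt0.
  have hQQ : Q * Q < Q * (2 * S + 3 / 4 * d * L) + d ^+ 2 / 4 * L ^+ 2.
    have := hQ; rewrite -(ltr_pM2l BB0); congr (_ < _); rewrite -eB; ring.
  have L2 := sqr_ge0 L.
  (* By [hB], Q^2 is at least Q(L^2 + 4S + dL). With [hQQ] this gives Q(L^2 + 2S + dL / 4) < d^2 L^2
     / 4, contradicting Q >= dL. *)
  have : 0 <= Q * (Q - (L ^+ 2 + 4 * S + d * L)).
    by rewrite mulr_ge0 ?subr_ge0 // ltW.
  have : 0 <= Q * (L ^+ 2 + 2 * S) by rewrite mulr_ge0 //; lra.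
  have : 0 <= d * L * (Q - d * L) by rewrite mulr_ge0 //; lra.
  lra.
exists x; split; last first.
  rewrite [g _]hx -[X in X - _]scale1r -scalerBl normrZ.
  by rewrite opprD addrA subrr add0r normrN gtr0_norm.
have hM : N <= BB * Num.max (Num.sqrt 2) (4 * BB / d).
  apply: (@le_trans _ _ (BB * (4 * BB / d))); last first.
    by rewrite ler_wpM2l // le_max lexx orbT.
  rewrite !mulrA ler_pdivlMr // -(ler_pM2l e0).
  have -> : e * (BB * 4 * BB) = 4 * (e * BB ^+ 2) by ring.
  rewrite eB mulrA; have : 0 <= d * (d - e * N) by rewrite mulr_ge0 //; lra.
  lra.
(* Passing from [hM] to [Phi] multiplies by a factor of at least 1 and adds nonnegative terms. *)
have ha1 : 1 <= 1 / (1 - a1) by rewrite ler_pdivlMr; lra.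
have : 0 <= a1 / (1 - a1) * L.
  by apply: mulr_ge0; [apply: divr_ge0; lra | exact: ltW].
rewrite /Phi -/BB -/k -/h -/L => ?.
apply: (le_trans hM); rewrite -addrA.
apply: (@le_trans _ _ (BB * Num.max (Num.sqrt 2) (4 * BB / d) * (1 / (1 - a1)))).
  by apply: ler_peMr => //; exact: le_trans hM.
by rewrite lerDl addr_ge0 // ltW.
Qed.

(** * Induction on the number of maps *)

(** The numerator is a(1 - b) + b(1 - a), and the denominator exceeds it by (1 - a)(1 - b). *)
Lemma star_itv (R : realType) (a b : R) :
  0 < a < 1 -> 0 < b < 1 -> 0 < star a b < 1.
Proof.
move=> /andP[a0 a1] /andP[b0 b1].
have h : 0 < 1 - a * b by nra.
by rewrite /star ltr_pdivrMr // mul1r divr_gt0 //=; nra.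
Qed.

Lemma star_all_itv (R : realType) (n : nat) (u : 'I_n.+1 -> R) :
  (forall i, 0 < u i < 1) -> 0 < star_all u < 1.
Proof.
elim: n u => [|n IH] u hu; first exact: hu.
apply: star_itv (hu _); apply: IH => i; exact: hu.
Qed.

Lemma comp_all_nonexpansive (R : realType) (X : hilbertType R) (n : nat)
  (f : 'I_n -> X -> X) : (forall i, nonexpansive (f i)) -> nonexpansive (comp_all f).
Proof.
elim: n f => [|n IH] f hf x y //=.
apply: le_trans (hf _ _ _) _; apply: IH => i; exact: hf.
Qed.

Theorem theorem2p3 (R : realType) (X : hilbertType R) (m : nat) (hm : (2 <= m)%N)
  (alpha : 'I_m -> R) (halpha : forall i : 'I_m, 0 < alpha i < 1)
  (f : 'I_m -> X -> X) (hf : forall i : 'I_m, averaged (alpha i) (f i))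
  (K : R -> R) (hK0 : forall e : R, 0 < e -> 0 < K e)
  (hK : forall (i : 'I_m) (e : R), 0 < e ->
     exists p : X, `|p| <= K e /\ `|p - f i p| <= e) :
  forall d : R, 0 < d ->
    exists p : X, `|p| <= Psi alpha K d /\ `|p - comp_all f p| <= d.
Proof.
have hne i : nonexpansive (f i) by exact: nonexpansive_averaged (halpha i) (hf i).
case: m hm alpha halpha f hf hK hne => [//|[//|m]] _.
elim: m => [|m IH] alpha halpha f hf hK hne d d0;
  have d40 : 0 < d / 4 by rewrite divr_gt0.
  have [p [hp hp']] := hK ord0 _ d40.
  have [q [hq hq']] := hK ord_max _ d40.
  (* For two maps, the inner factor of [comp_all f] is [init f ord_max], whose index has value 0. *)
  have fE : init f ord_max = f ord0 by congr (f _); exact: val_inj.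
  have := comp_approx_fixpoint (halpha ord0) (halpha ord_max) d0 (hK0 _ d40)
            (hne ord0) (hf ord_max) hp hp' hq hq'.
  by rewrite -fE.
have [p [hp hp']] : exists p : X, `|p| <= Psi (init alpha) K (d / 4) /\
    `|p - comp_all (init f) p| <= d / 4.
  by apply: IH => // i; [exact: halpha | exact: hf | exact: hK | exact: hne].
have [q [hq hq']] := hK ord_max _ d40.
(* The maximum bounds both the point given by induction for the first maps and the one given by [K]
   for the last map; its positivity comes from [K]. *)
set K' := fun r => Num.max (Psi (init alpha) K r) (K r).
have hpK : `|p| <= K' (d / 4) by rewrite le_max hp.
have hqK : `|q| <= K' (d / 4) by rewrite le_max hq orbT.
have hK'0 : 0 < K' (d / 4) by rewrite lt_max hK0 ?orbT.
have ha1 : 0 < star_all (init alpha) < 1.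
  by apply: star_all_itv => i; exact: halpha.
have hfi : nonexpansive (comp_all (init f)).
  by apply: comp_all_nonexpansive => i; exact: hne.
exact: (comp_approx_fixpoint ha1 (halpha ord_max) d0 hK'0 hfi (hf ord_max)
          hpK hp' hqK hq').
Qed.
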